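(* There exists an absolute constant $\epsilon_0<1$ such that the following holds. Any algorithm that, given a parameter $\epsilon\in(0,\epsilon_0]$ and sample access to product distributions $P,Q$ over $\{0,1\}^n$, distinguishes between $\|P-Q\|_1<\epsilon/2$ and $\|P-Q\|_1>\epsilon$ with probability at least $2/3$ requires $\Omega(n/\log n)$ samples. Moreover, the lower bound still holds in the case where $Q$ is known and provided as an explicit parameter.
   Context: A product distribution over $\{0,1\}^n$ is one with independent coordinates. $\|P-Q\|_1=\sum_x|P(x)-Q(x)|$. *)

(* Defs.v *)
From HB Require Import structures.
From mathcomp Require Import all_boot all_order all_algebra.
From mathcomp Require Import all_classical all_reals all_analysis.

Set Implicit Arguments.
Unset Strict Implicit.
Unset Printing Implicit Defensive.

Import Order.TTheory GRing.Theory Num.Theory.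

Local Open Scope ring_scope.

Notation cube n := {ffun 'I_n -> bool}.

Definition is_distribution (R : realType) (T : finType) (P : {ffun T -> R})
    : Prop :=
  (forall x, 0 <= P x) /\ \sum_x P x = 1.

Definition l1dist (R : realType) (T : finType) (P Q : {ffun T -> R}) : R :=
  \sum_x `|P x - Q x|.

Definition marginal (R : realType) (n : nat) (P : {ffun cube n -> R})
    (i : 'I_n) (b : bool) : R :=
  \sum_(x : cube n | x i == b) P x.

(* The coordinates are independent: the joint mass function is the product of
   the mass functions of the coordinates. *)
Definition is_product_distribution (R : realType) (n : nat)
    (P : {ffun cube n -> R}) : Prop :=
  is_distribution P /\ forall x, P x = \prod_(i < n) marginal P i (x i).

Definition iid (R : realType) (T : finType) (P : {ffun T -> R}) (m : nat)
    (s : m.-tuple T) : R :=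
  \prod_(i < m) P (tnth s i).

(* A randomized algorithm enters only through its acceptance function: the
   probability, over its internal randomness, that it answers "close" on the
   given samples; it answers "far" otherwise. *)
Definition accept_prob (R : realType) (T : finType) (P : {ffun T -> R})
    (m : nat) (A : m.-tuple T -> R) : R :=
  \sum_(s : m.-tuple T) iid P s * A s.

Definition accept_prob2 (R : realType) (T : finType) (P Q : {ffun T -> R})
    (mP mQ : nat) (A : mP.-tuple T -> mQ.-tuple T -> R) : R :=
  \sum_(s : mP.-tuple T) \sum_(t : mQ.-tuple T) iid P s * iid Q t * A s t.

(* [a] is the probability of the answer "close", [d] the L1 distance. *)
Definition correct_answer (R : realType) (eps d a : R) : Prop :=
  (d < eps / 2 -> 2 / 3 <= a) /\ (eps < d -> 2 / 3 <= 1 - a).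

Definition closeness_tester (R : realType) (n : nat) (eps : R) (mP mQ : nat)
    (A : mP.-tuple (cube n) -> mQ.-tuple (cube n) -> R) : Prop :=
  (forall s t, 0 <= A s t <= 1) /\
  forall P Q : {ffun cube n -> R},
    is_product_distribution P -> is_product_distribution Q ->
    correct_answer eps (l1dist P Q) (accept_prob2 P Q A).

(* Here the algorithm receives the whole mass function of [Q] as input. *)
Definition identity_tester (R : realType) (n : nat) (eps : R) (m : nat)
    (A : {ffun cube n -> R} -> m.-tuple (cube n) -> R) : Prop :=
  (forall Q s, 0 <= A Q s <= 1) /\
  forall P Q : {ffun cube n -> R},
    is_product_distribution P -> is_product_distribution Q ->
    correct_answer eps (l1dist P Q) (accept_prob P (A Q)).

(* Main.v *)
Require Import Defs.
From HB Require Import structures.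
From mathcomp Require Import all_boot all_order all_algebra.
From mathcomp Require Import all_classical all_reals all_analysis.
From mathcomp Require Import ring lra zify.

(** Let [Q] be the product of [n] Bernoulli variables of mean [delta / n], with
[delta = 4 eps], and let [P] have means [delta * X_i / n] for i.i.d. random
[X_i].  Two laws of [X] are used, [near] and [far], supported on the nodes
[0], [1], [51] and [K (k+1)^2] for [k < L].  They are the negative and the
positive part of the weights of the divided difference at these nodes, so their
moments of order less than [L + 2] agree.  The quadratic growth of the large
nodes gives them a negligible weight: [near] is almost concentrated at [1],
whereas [far] has most of its mass at [0].  Hence [P] is close to [Q] under
[near], and under [far] the points of the cube with a single nonzero coordinate
already show that it is far from [Q].

The [n] columns of a sample are independent, and the law of a column of length
[m] is a mixture of polynomials in the mean.  Matching moments make the two laws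
of a column differ by at most [2 (1 + 8 K L^2 / n)^m / 4^L] in L1, which is at
most [2 / 2^L] as soon as [16 K L m <= n].  With [L] slightly above [log_2 n]
the samples do not separate the two cases, so a tester needs more than
[n / (16 K L)] samples. *)

Set Implicit Arguments.
Unset Strict Implicit.
Unset Printing Implicit Defensive.

Import Order.TTheory GRing.Theory Num.Theory.
Local Open Scope ring_scope.

(** * Moment matching *)

(** Lagrange interpolation at the [N + 1] nodes reproduces [X^t], and the sum is the coefficient of
    [X^N] in the interpolant, which is [0] for [t < N]. *)
Lemma divided_difference_exp (F : fieldType) (N : nat) (x : 'I_N.+1 -> F)
    (t : nat) : injective x -> (t < N)%N ->
  \sum_j x j ^+ t / \prod_(i | i != j) (x j - x i) = 0.
Proof.
move=> x_inj ltN.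
pose l j := \prod_(i < N.+1 | i != j) ('X - (x i)%:P) : {poly F}.
have l_size j : size (l j) = N.+1.
  rewrite /l -big_filter size_prod_XsubC.
  by case: big_enumP => e _ _ [_ ->]; rewrite cardC1 card_ord.
have lE j k : (l j).[x k] = \prod_(i | i != j) (x k - x i).
  by rewrite horner_prod; apply: eq_bigr => i _; rewrite hornerXsubC.
pose d j := \prod_(i | i != j) (x j - x i).
have d_neq0 j : d j != 0.
  apply/prodf_neq0 => i ij; rewrite subr_eq0; apply/eqP => /x_inj e.
  by rewrite e eqxx in ij.
pose p : {poly F} := 'X^t - \sum_j (x j ^+ t / d j) *: l j.
have p0 : p = 0.
  apply: (@roots_geq_poly_eq0 _ _ [seq x j | j <- enum 'I_N.+1]).
  - apply/allP => _ /mapP[k _ ->];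
    rewrite /root hornerD hornerN hornerXn horner_sum.
    rewrite (bigD1 k) //= big1 => [|j jk]; last first.
      by rewrite hornerZ lE (bigD1 k) 1?eq_sym //= subrr mul0r mulr0.
    by rewrite hornerZ lE -/(d k) divfK ?d_neq0 // addr0 subrr.
  - by rewrite map_inj_uniq // enum_uniq.
  rewrite size_map size_enum_ord.
  apply: (leq_trans (size_polyD _ _)); rewrite geq_max size_polyN size_polyXn.
  rewrite ltnW //=; apply: leq_trans (size_sum _ _ _) _.
  apply/bigmax_leqP => j _.
  by rewrite (leq_trans (size_scale_leq _ _)) // l_size.
have := congr1 (fun q : {poly F} => q`_N) p0.
rewrite coefB coefXn coef_sum coef0 gtn_eqF // sub0r => /eqP; rewrite oppr_eq0.
move=> /eqP e; rewrite -[RHS]e; apply: eq_bigr => j _; rewrite coefZ.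
have /monicP : l j \is monic by apply: monic_prod => i _; apply: monicXsubC.
by rewrite /lead_coef l_size /= => ->; rewrite mulr1.
Qed.

(** * Interpolation products at the squares *)

(** Since [(k+1)^2 - (i+1)^2 = (k-i)(k+i+2)], the product collapses to factorials. *)
Lemma prod_square_ratio_below (R : realFieldType) (k L : nat) : (L <= k)%N ->
  (\prod_(i < L) ((i.+1)%:R ^+ 2 / `|k.+1%:R ^+ 2 - i.+1%:R ^+ 2|))
    * (k`! * (k + L).+1`!)%:R = (L`! ^ 2 * ((k - L)`! * k.+1`!))%:R :> R.
Proof.
elim: L => [|L IHL] Lk.
  by rewrite big_ord0 mul1r addn0 subn0 /= mul1n.
rewrite big_ord_recr /= addnS factS.
have /IHL IH : (L <= k)%N by lia.
have {}Lk : exists j, k = (L + j.+1)%N by exists (k - L).-1; lia.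
case: Lk IH => j -> {IHL}.
have -> : (L + j.+1 - L = j.+1)%N by lia.
have -> : (L + j.+1 - L.+1 = j)%N by lia.
rewrite [j.+1`!]factS [L.+1`!]factS.
set P := \prod_(_ < _) _; set a := _`!; set b := _`!; set c := _`!.
set d := _`!; set e := _`! => IH; clearbody P a b c d e.
rewrite ger0_norm; last first.
  by rewrite subr_ge0 lerXn2r ?nnegrE ?ler0n // ler_nat; lia.
have -> : (L + j.+1).+1%:R ^+ 2 - L.+1%:R ^+ 2
    = j.+1%:R * (L + j.+1 + L).+2%:R :> R.
  by rewrite -!natr1 !natrD -!natr1; ring.
move: IH; rewrite -mulnn -[in X in _ -> X]mulnn !natrM => IH.
have jn : j.+1%:R != 0 :> R by rewrite pnatr_eq0.
have sn : (L + j.+1 + L).+2%:R != 0 :> R by rewrite pnatr_eq0.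
move: (j.+1%:R : R) ((L + j.+1 + L).+2%:R : R) jn sn IH => y z y0 z0 IH.
transitivity (L.+1%:R ^+ 2 / y * (P * (a%:R * b%:R))).
  by field; rewrite y0 z0.
by rewrite IH; field.
Qed.

(** Induction on the number [j] of factors above the omitted index [k]. The base case is the
    previous closed form at [L = k], and the [2] is [(2k+2)/(k+1)]. *)
Lemma prod_square_ratio_above (R : realFieldType) (k j : nat) :
  (\prod_(i < k + j.+1 | i != k :> nat)
      (i.+1%:R ^+ 2 / `|k.+1%:R ^+ 2 - i.+1%:R ^+ 2|))
    * (j`! * (k + j.+1 + k.+1)`!)%:R = (2 * (k + j.+1)`! ^ 2)%:R :> R.
Proof.
elim: j => [|j IHj].
  rewrite addn1 big_mkcond big_ord_recr /= eqxx mulr1.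
  have := @prod_square_ratio_below R k k (leqnn k).
  have -> : \prod_(i < k) (if i != k :> nat
      then i.+1%:R ^+ 2 / `|k.+1%:R ^+ 2 - i.+1%:R ^+ 2| else 1)
    = \prod_(i < k) (i.+1%:R ^+ 2 / `|k.+1%:R ^+ 2 - i.+1%:R ^+ 2|) :> R.
    by apply: eq_bigr => i _; rewrite ltn_eqF.
  set P := \prod_(_ < _) _ => IH.
  have e : (k.+1 + k.+1 = (k + k).+2)%N by lia.
  have k0 : k`!%:R != 0 :> R by rewrite pnatr_eq0 -lt0n fact_gt0.
  move: IH; rewrite e [(k + k).+2`!]factS subnn [k.+1`!]factS fact0 !mul1n.
  move: k`! (k + k).+1`! k0 => a b a0 IH; clearbody P.
  apply: (mulfI a0).
  transitivity ((k + k).+2%:R * (P * (a * b)%:R)).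
    by rewrite !natrM; ring.
  by rewrite IH -!mulnn !natrM -e natrD; ring.
rewrite addnS big_mkcond big_ord_recr /= -big_mkcond /=.
rewrite ifT; last by lia.
move: IHj; set P := \prod_(_ < _ | _) _ => IH.
rewrite ler0_norm; last first.
  by rewrite subr_le0 lerXn2r ?nnegrE ?ler0n // ler_nat; lia.
have -> : - (k.+1%:R ^+ 2 - (k + j.+1).+1%:R ^+ 2)
    = j.+1%:R * (k + j.+1 + k.+1).+1%:R :> R.
  by rewrite -!natr1 !natrD -!natr1; ring.
have jn : j.+1%:R != 0 :> R by rewrite pnatr_eq0.
have sn : (k + j.+1 + k.+1).+1%:R != 0 :> R by rewrite pnatr_eq0.
move: IH; rewrite addSn [(_ + _).+1`!]factS [j.+1`!]factS.
rewrite [(k + j.+1).+1`!]factS.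
move: j`! (k + j.+1 + k.+1)`! (k + j.+1)`! => a b c IH; clearbody P.
rewrite !natrM in IH *.
move: (j.+1%:R : R) ((k + j.+1 + k.+1).+1%:R : R) jn sn => y z y0 z0.
transitivity ((k + j.+1).+1%:R ^+ 2 * (P * (a%:R * b%:R))).
  by field; rewrite y0 z0.
by rewrite IH; ring.
Qed.

(** Log-convexity of the factorial: [k + j] is the midpoint of [j] and [j + 2k]. *)
Lemma fact_sqr_le (j k : nat) : ((k + j)`! ^ 2 <= j`! * (k + j + k)`!)%N.
Proof.
elim: k j => [|k IHk] j; first by rewrite addn0 mulnn.
have := IHk j.+1; rewrite -addSnnS => /leq_trans; apply.
rewrite factS (_ : (k.+1 + j + k.+1 = (k.+1 + j + k).+1)%N) ?addnS //.
rewrite [(_ + _).+1`!]factS -mulnA [X in (_ <= X)%N]mulnCA.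
by rewrite leq_mul2r; apply/orP; right; lia.
Qed.

(** The closed form is twice a quotient that log-convexity bounds by [1]. Uniformity in [k] and [L]
    is what the quadratic spacing of the nodes buys. *)
Lemma prod_square_ratio_le2 (R : realFieldType) (k L : nat) : (k < L)%N ->
  \prod_(i < L | i != k :> nat)
      (i.+1%:R ^+ 2 / `|k.+1%:R ^+ 2 - i.+1%:R ^+ 2|) <= 2 :> R.
Proof.
move=> kL; have -> : L = (k + (L - k.+1).+1)%N by lia.
move: (L - k.+1)%N => j; have := prod_square_ratio_above R k j.
set P := \prod_(_ < _ | _) _ => IH.
have c0 : 0 < (j`! * (k + j.+1 + k.+1)`!)%:R :> R.
  by rewrite ltr0n muln_gt0 !fact_gt0.
rewrite -(ler_pM2r c0) IH -natrM ler_nat leq_mul2l /=.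
by have := fact_sqr_le j k.+1; rewrite addSnnS.
Qed.

Lemma sum_inv_sqr_le2 (R : realFieldType) (L : nat) :
  \sum_(k < L) (k.+1%:R ^+ 2)^-1 <= 2 :> R.
Proof.
(* The subtracted term makes the induction telescope: [1/(l+2)^2 <= 1/(l+1) - 1/(l+2)]. *)
suff h l : \sum_(k < l.+1) (k.+1%:R ^+ 2)^-1 <= 2 - l.+1%:R^-1 :> R.
  case: L => [|L]; first by rewrite big_ord0.
  by apply: le_trans (h L) _; rewrite lerBlDr lerDl invr_ge0.
elim: l => [|l IHl].
  by rewrite big_ord_recr big_ord0 /= add0r expr1n invr1; lra.
rewrite big_ord_recr /=; apply: le_trans (lerD IHl (lexx _)) _.
rewrite -[l.+2]addn1 natrD; move: (l.+1%:R : R) (ltr0Sn R l) => x x0.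
rewrite -subr_ge0.
have -> : 2 - (x + 1)^-1 - (2 - x^-1 + ((x + 1) ^+ 2)^-1)
   = (x * (x + 1) ^+ 2)^-1.
  by field; apply/andP; split; lra.
by rewrite invr_ge0 mulr_ge0 ?sqr_ge0 // ltW.
Qed.

(** The Weierstrass product inequality. *)
Lemma prod_one_sub_ge (R : realDomainType) (L : nat) (f : 'I_L -> R) :
  (forall i, 0 <= f i <= 1) -> 1 - \sum_i f i <= \prod_i (1 - f i).
Proof.
elim: L f => [|L IHL] f f01; first by rewrite !big_ord0 subr0.
rewrite !big_ord_recl.
have := IHL (fun i => f (lift ord0 i)) (fun i => f01 _).
set S := \sum_(_ < _) _; set P := \prod_(_ < _) _ => IH.
have [f0 f1] := andP (f01 ord0).
have S0 : 0 <= S by apply: sumr_ge0 => i _; have /andP[] := f01 (lift ord0 i).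
have : (1 - f ord0) * (1 - S) <= (1 - f ord0) * P.
  by rewrite ler_wpM2l // subr_ge0.
have : 0 <= f ord0 * S by rewrite mulr_ge0.
lra.
Qed.

(** * The two priors with matching moments *)

(** On [0], [1], [51] alone the divided difference has weights [1/51], [-1/50], [1/2550], whose
    positive part has [50/51] of its mass at [0]. The other nodes are far enough away to keep most
    of that mass there. *)
Definition node (R : pzRingType) (K : R) (j : nat) : R :=
  match j with
  | 0%N => 0
  | 1%N => 1
  | 2%N => 51
  | k.+3 => K * k.+1%:R ^+ 2
  end.

Section MatchedPriors.
Variables (R : realFieldType) (K : R) (L : nat).
Hypothesis K_ge : 1000 * 100 <= K.

Let X (k : nat) : R := K * k.+1%:R ^+ 2.

Let K_gt0 : 0 < K. Proof. have := K_ge; lra. Qed.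

Let X_ge k : K <= X k.
Proof.
by rewrite ler_peMr ?(ltW K_gt0) // exprn_ege1 // ler1n.
Qed.

Let X_gt0 k : 0 < X k. Proof. exact: lt_le_trans (X_ge k). Qed.

Let node_lt i j : (i < j)%N -> node K i < node K j.
Proof.
have Xlt a b : (a < b)%N -> X a < X b.
  by move=> ab; rewrite ltr_pM2l // ltrXn2r ?nnegrE // ltr_nat.
have Xl a : 51 < X a by have := K_ge; have := X_ge a; lra.
case: i j => [|[|[|i]]] [|[|[|j]]] //= ij; rewrite -?/(X _) ?ltr01; try lra.
- by have := Xl j; lra.
- by have := Xl j; lra.
- exact: Xl.
exact: Xlt.
Qed.

Let node_inj : injective (fun j : 'I_L.+3 => node K j).
Proof.
move=> i j eij; apply: val_inj.
by case: (ltngtP i j) => // /node_lt; rewrite eij ltxx.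
Qed.

Let sum3 (F : nat -> R) :
  \sum_(j < L.+3) F j = F 0%N + F 1%N + F 2%N + \sum_(k < L) F k.+3.
Proof. by rewrite !big_ord_recl !addrA. Qed.

Let prod3 (F : nat -> R) :
  \prod_(j < L.+3) F j = F 0%N * F 1%N * F 2%N * \prod_(k < L) F k.+3.
Proof. by rewrite !big_ord_recl !mulrA. Qed.

Let den (j : nat) : R := \prod_(i < L.+3 | i != j :> nat) (node K j - node K i).
(** The value [1] at [i = j] turns the filtered product into a full one, which [prod3] can split. *)
Let d (j i : nat) : R := if i != j then node K j - node K i else 1.

Let den3 j : den j = d j 0 * d j 1 * d j 2 * \prod_(k < L) d j k.+3.
Proof. by rewrite /den big_mkcond; exact: (prod3 (d j)). Qed.

(* The factor normalises the divided difference so that [v 0 = 1 / 51] for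
   every [L]. *)
Let v (j : nat) : R := \prod_(k < L) (- X k) / den j.

Let v_moment t : (t < L.+2)%N -> \sum_(j < L.+3) v j * node K j ^+ t = 0.
Proof.
move=> tL; have := divided_difference_exp node_inj tL.
move=> /(congr1 (fun y => \prod_(k < L) (- X k) * y)); rewrite mulr0 mulr_sumr.
by move=> e; rewrite -[RHS]e; apply: eq_bigr => j _; rewrite /v mulrAC mulrA.
Qed.

Let oppX_neq0 : \prod_(k < L) (- X k) != 0.
Proof. by apply/prodf_neq0 => k _; rewrite oppr_eq0 gt_eqF. Qed.

Let v0E : v 0 = 1 / 51.
Proof.
rewrite /v den3 /d /=.
under [X in _ / (_ * X)]eq_bigr do rewrite -/(X _) sub0r.
by field; rewrite oppX_neq0.
Qed.

(** The quotient is the inverse of the product of the [1 - c / X k], and the [c / X k] sum to at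
    most [102 / K <= 1/2]. Hence the large nodes change the weights at [1] and [51] by a factor
    between [1] and [2]. *)
Let v_small (c : R) : 0 <= c <= 51 ->
  1 <= (\prod_(k < L) (- X k)) / (\prod_(k < L) (c - X k)) <= 2.
Proof.
move=> /andP[c0 c51].
have Xc k : 0 < X k - c by have := K_ge; have := X_ge k; lra.
have -> : (\prod_(k < L) (- X k)) / (\prod_(k < L) (c - X k))
    = (\prod_(k < L) (1 - c / X k))^-1.
  rewrite -prodf_div -prodfV; apply: eq_bigr => k _.
  rewrite -[c - _]opprB; field.
  by rewrite !gt_eqF.
have f01 (k : 'I_L) : 0 <= c / X k <= 1.
  rewrite divr_ge0 ?(ltW (X_gt0 k)) //= ler_pdivrMr // mul1r.
  by have := Xc k; lra.
have lo := prod_one_sub_ge f01.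
have S : \sum_(k < L) c / X k <= 1 / 2.
  apply: (@le_trans _ _ (51 / K * 2)); last first.
    by rewrite mulrAC ler_pdivrMr //; have := K_ge; lra.
  apply: le_trans (ler_wpM2l _ (sum_inv_sqr_le2 R L)); last first.
    by rewrite divr_ge0 // ltW.
  rewrite mulr_sumr; apply: ler_sum => k _.
  rewrite /X invfM mulrA ler_wpM2r ?invr_ge0 ?sqr_ge0 //.
  by rewrite ler_wpM2r // invr_ge0 ltW.
have hi : \prod_(k < L) (1 - c / X k) <= 1.
  by apply: prodr_ile1 => k _; have := f01 k; lra.
rewrite invf_ge1 ?hi /=; last by lra.
by rewrite invf_ple ?posrE; lra.
Qed.

Let v1_le : v 1 <= - (1 / 50).
Proof.
have := @v_small 1 (ltac:(lra)); rewrite /v den3 /d /= /X.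
set a := \prod_(_ < _) _; set b := \prod_(_ < _) _ => /andP[h _].
(* As [0^-1 = 0], a zero [b] would contradict [1 <= a / b]. *)
have b0 : b != 0 by apply: contraTneq h => ->; rewrite invr0 mulr0 -ltNge ltr01.
have -> : a / ((1 - 0) * 1 * (1 - 51) * b) = - (1 / 50) * (a / b) by field.
lra.
Qed.

Let v2_bounds : 0 <= v 2 <= 1 / 1275.
Proof.
have := @v_small 51 (ltac:(lra)); rewrite /v den3 /d /= /X.
set a := \prod_(_ < _) _; set b := \prod_(_ < _) _ => /andP[h h'].
have b0 : b != 0 by apply: contraTneq h => ->; rewrite invr0 mulr0 -ltNge ltr01.
have -> : a / ((51 - 0) * (51 - 1) * 1 * b) = 1 / 2550 * (a / b) by field.
lra.
Qed.

(** The numerator's factor [X k] cancels the distance to node [0], the other large nodes contribute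
    at most [2], and [X k - 51 >= X k / 2]. The weight [X k - 1] is the distance to node [1]. *)
Let v_big (k : 'I_L) : `|v k.+3| * (X k - 1) <= 4 / X k.
Proof.
have Xk := X_ge k; have Kge := K_ge.
have Xne (i : 'I_L) : i != k -> `|X k - X i| != 0.
  move=> ik; rewrite normr_eq0 subr_eq0; apply/eqP => e; case/eqP: ik.
  have := @node_inj (lift ord0 (lift ord0 (lift ord0 i)))
                    (lift ord0 (lift ord0 (lift ord0 k))) (esym e).
  by move=> /lift_inj/lift_inj/lift_inj.
have -> : `|v k.+3| = (\prod_(i < L | i != k :> nat) (X i / `|X k - X i|))
    / ((X k - 1) * (X k - 51)).
  rewrite /v den3 /d /=.
  rewrite normrM normfV !normrM normr_prod (bigD1 k) //=.
  rewrite -big_mkcond /= normr_prod subr0 -/(X k).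
  rewrite normrN !ger0_norm ?subr_ge0; try lra.
  under [in LHS]eq_bigr do rewrite normrN ger0_norm ?(ltW (X_gt0 _)) //.
  rewrite prodf_div.
  set a := \prod_(_ < _ | _) _; set b := \prod_(_ < _ | _) _.
  have b0 : b != 0 by apply/prodf_neq0 => i; exact: Xne.
  by field; rewrite b0 !gt_eqF //; lra.
have r2 : \prod_(i < L | i != k :> nat) (X i / `|X k - X i|) <= 2.
  apply: le_trans (prod_square_ratio_le2 R (ltn_ord k)).
  rewrite le_eqVlt; apply/orP; left; apply/eqP; apply: eq_bigr => i _.
  rewrite /X -mulrBr normrM (ger0_norm (ltW K_gt0)) -mulf_div divff ?mul1r //.
  by rewrite gt_eqF.
set r := \prod_(_ < _ | _) _ in r2 *.
have -> : r / ((X k - 1) * (X k - 51)) * (X k - 1) = r / (X k - 51).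
  by field; rewrite !gt_eqF //; lra.
rewrite ler_pdivrMr; last by lra.
rewrite mulrAC ler_pdivlMr //.
have : r * X k <= 2 * X k by rewrite ler_wpM2r // ltW.
lra.
Qed.

Let sum_big : \sum_(k < L) `|v k.+3| * (X k - 1) <= 8 / (1000 * 100).
Proof.
apply: (@le_trans _ _ (4 / K * 2)); last first.
  rewrite mulrAC ler_pdivrMr //; have := K_ge; lra.
apply: le_trans (ler_wpM2l _ (sum_inv_sqr_le2 R L)); last first.
  by rewrite divr_ge0 // ltW.
rewrite mulr_sumr; apply: ler_sum => k _; apply: le_trans (v_big k) _.
by rewrite /X invfM mulrA.
Qed.

(** The positive and negative parts of [v] have the same mass [Z], because the moment of order [0]
    vanishes. After division by [Z] their difference is [v / Z], which inherits the vanishing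
    moments. *)
Lemma matched_priors :
  exists far near : 'I_L.+3 -> R,
    [/\ (forall j, 0 <= far j) /\ \sum_j far j = 1,
        (forall j, 0 <= near j) /\ \sum_j near j = 1,
        forall t, (t < L.+2)%N ->
          \sum_j (far j - near j) * node K j ^+ t = 0,
        19 / 20 <= far ord0
      & \sum_j near j * `|node K j - 1| <= 1 / 200].
Proof.
pose pos j := (`|v j| + v j) / 2; pose neg j := (`|v j| - v j) / 2.
have pos0 j : 0 <= pos j.
  by rewrite /pos; have := ler_norm (- v j); rewrite normrN; lra.
have neg0 j : 0 <= neg j by rewrite /neg; have := ler_norm (v j); lra.
pose Z := \sum_(j < L.+3) pos j.
have ZE : Z = \sum_(j < L.+3) neg j.
  apply: subr0_eq; rewrite -sumrB -[RHS](v_moment (ltn0Sn _)).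
  by apply: eq_bigr => j _; rewrite expr0 mulr1 /pos /neg; field.
(* Computed on the negative side, where node [1] alone contributes [1/50]. *)
have Z_ge : 1 / 50 <= Z.
  rewrite ZE (sum3 neg).
  have : 0 <= \sum_(k < L) neg k.+3 by apply: sumr_ge0.
  have : 1 / 50 <= neg 1%N by rewrite /neg ler0_norm; have := v1_le; lra.
  have := neg0 0%N; have := neg0 2%N; lra.
have Z_gt0 : 0 < Z by lra.
(* The mass of [far] at [0] is [(1 / 51) / Z], so this bound is exactly what [19 / 20] asks for. *)
have Z_le : Z <= 20 / 19 * (1 / 51).
  rewrite /Z (sum3 pos).
  have -> : pos 0%N = 1 / 51 by rewrite /pos v0E ger0_norm; lra.
  have -> : pos 1%N = 0 by rewrite /pos ler0_norm; have := v1_le; lra.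
  have -> : pos 2%N = v 2%N.
    by have /andP[? ?] := v2_bounds; rewrite /pos ger0_norm //; lra.
  have : \sum_(k < L) pos k.+3 <= \sum_(k < L) `|v k.+3| * (X k - 1).
    apply: ler_sum => k _; apply: (@le_trans _ _ `|v k.+3|).
      by rewrite /pos; have := ler_norm (v k.+3); lra.
    by rewrite ler_peMr //; have := K_ge; have := X_ge k; lra.
  have := sum_big; have /andP[_ +] := v2_bounds; lra.
exists (fun j => pos j / Z), (fun j => neg j / Z); split.
- split=> [j|]; first by rewrite divr_ge0 // ltW.
  by rewrite -mulr_suml divff // gt_eqF.
- split=> [j|]; first by rewrite divr_ge0 // ltW.
  by rewrite -mulr_suml -ZE divff // gt_eqF.
- move=> t tL; under eq_bigr => j _.
    have -> : (pos j / Z - neg j / Z) * node K j ^+ t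
        = Z^-1 * (v j * node K j ^+ t).
      by rewrite /pos /neg; field; rewrite gt_eqF.
    over.
  by rewrite -mulr_sumr v_moment // mulr0.
- rewrite ler_pdivlMr //= /pos v0E ger0_norm; last by lra.
  lra.
under eq_bigr do rewrite mulrAC.
rewrite -mulr_suml ler_pdivrMr //.
(* Only the large nodes contribute: [neg] vanishes at [0] and [51], and [1] is at distance [0]. The
   bound on [Z] from below gives the rest. *)
apply: (@le_trans _ _ (8 / (1000 * 100))); last by lra.
apply: le_trans sum_big; rewrite (sum3 (fun j => neg j * `|node K j - 1|)).
have -> : neg 0%N = 0 by rewrite /neg v0E ger0_norm; lra.
have -> : neg 2%N = 0.
  by have /andP[? ?] := v2_bounds; rewrite /neg ger0_norm //; lra.
rewrite /= subrr normr0 !mul0r mulr0 !add0r; apply: ler_sum => k _.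
rewrite -/(X k) ger0_norm; last by have := K_ge; have := X_ge k; lra.
rewrite ler_wpM2r //; first by have := K_ge; have := X_ge k; lra.
by rewrite /neg; have := ler_norm (- v k.+3); rewrite normrN; lra.
Qed.

End MatchedPriors.

(** * Product distributions *)

(* Hybrid argument: the factors [f i] are replaced by [g i] one at a time. *)
Lemma l1_prod_le (R : realDomainType) (C : finType) (n : nat)
    (f g : 'I_n -> C -> R) :
  (forall i c, 0 <= f i c) -> (forall i c, 0 <= g i c) ->
  (forall i, \sum_c f i c = 1) -> (forall i, \sum_c g i c = 1) ->
  \sum_(x : {ffun 'I_n -> C}) `|\prod_i f i (x i) - \prod_i g i (x i)|
    <= \sum_i \sum_c `|f i c - g i c|.
Proof.
move=> f0 g0 f1 g1.
(* The hybrid [h k] takes its first [k] factors from [f]; [u k] holds the factors of the distance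
   between [h k] and [h k.+1]. *)
pose h (k : nat) (i : 'I_n) c := if (i < k)%N then f i c else g i c.
pose u (k i : 'I_n) c := if i == k then `|f i c - g i c| else h k i c.
have hE (k : 'I_n) (x : {ffun 'I_n -> C}) :
    `|\prod_i h k.+1 i (x i) - \prod_i h k i (x i)| = \prod_i u k i (x i).
  rewrite (bigD1 k) //= [X in _ - X](bigD1 k) //= [RHS](bigD1 k) //=.
  have -> : \prod_(i | i != k) h k.+1 i (x i) = \prod_(i | i != k) h k i (x i).
    apply: eq_bigr => i ik; rewrite /h ltnS leq_eqVlt.
    by rewrite (_ : (i == k :> nat) = false) //; apply/negbTE.
  rewrite -mulrBl normrM {1}/u eqxx /h ltnS leqnn ltnn; congr (_ * _).
  rewrite ger0_norm; first by apply: eq_bigr => i /negbTE ik; rewrite /u ik.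
  by apply: prodr_ge0 => i _; case: ifP.
have uE (k : 'I_n) :
    \sum_(x : {ffun 'I_n -> C}) \prod_i u k i (x i) = \sum_c `|f k c - g k c|.
  rewrite -(bigA_distr_bigA (u k)) (bigD1 k) //= [X in _ * X]big1 => [|i ik].
    by rewrite mulr1; apply: eq_bigr => c _; rewrite /u eqxx.
  rewrite /u (negbTE ik) /h; case: (i < k)%N; [exact: f1 | exact: g1].
under [X in _ <= X]eq_bigr do rewrite -uE.
rewrite exchange_big /=; apply: ler_sum => x _.
under [X in _ <= X]eq_bigr do rewrite -hE.
have -> : \prod_i f i (x i) = \prod_i h n i (x i).
  by apply: eq_bigr => i _; rewrite /h ltn_ord.
have -> : \prod_i g i (x i) = \prod_i h 0%N i (x i) by [].
rewrite -(telescope_sumr (fun k => \prod_i h k i (x i)) (leq0n n)) big_mkord.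
exact: ler_norm_sum.
Qed.

(** The factor [h] is absorbed into coordinate [i], and every other coordinate sums to [1]. *)
Lemma sum_prod_marginal (R : comPzSemiRingType) (I J : finType)
    (mu : I -> J -> R) (i : I) (h : J -> R) :
  (forall k, \sum_j mu k j = 1) ->
  \sum_(a : {ffun I -> J}) (\prod_k mu k (a k)) * h (a i)
    = \sum_j mu i j * h j.
Proof.
move=> mu1; pose u k j := mu k j * (if k == i then h j else 1).
transitivity (\sum_(a : {ffun I -> J}) \prod_k u k (a k)).
  apply: eq_bigr => a _; rewrite big_split /=; congr (_ * _).
  by rewrite (bigD1 i) //= eqxx big1 ?mulr1 // => k /negbTE ->.
rewrite -(bigA_distr_bigA u) (bigD1 i) //= [X in _ * X]big1 => [|k /negbTE ki].
  by rewrite mulr1; apply: eq_bigr => j _; rewrite /u eqxx.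
by rewrite /u ki; under eq_bigr do rewrite mulr1; exact: mu1.
Qed.

Lemma sum_prod_distr (R : comPzSemiRingType) (I J : finType)
    (mu : I -> J -> R) :
  (forall k, \sum_j mu k j = 1) ->
  \sum_(a : {ffun I -> J}) \prod_k mu k (a k) = 1.
Proof. by move=> mu1; rewrite -(bigA_distr_bigA mu) big1. Qed.

(** * Products of Bernoulli laws *)

Definition bern (R : pzRingType) (p : R) (b : bool) : R :=
  if b then p else 1 - p.

Definition bern_prod (R : realType) (n : nat) (p : 'I_n -> R) :
    {ffun cube n -> R} :=
  [ffun x : cube n => \prod_i bern (p i) (x i)].

Lemma bern_ge0 (R : realDomainType) (p : R) b : 0 <= p <= 1 -> 0 <= bern p b.
Proof. by case/andP=> p0 p1; case: b; rewrite /bern ?subr_ge0. Qed.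

Lemma sum_bern (R : pzRingType) (p : R) : \sum_b bern p b = 1.
Proof. by rewrite big_bool /= addrC subrK. Qed.

Lemma bern_prodP (R : realType) (n : nat) (p : 'I_n -> R) :
  (forall i, 0 <= p i <= 1) -> is_product_distribution (bern_prod p).
Proof.
move=> p01; have s1 i : \sum_b bern (p i) b = 1 by exact: sum_bern.
split; first split.
- by move=> x; rewrite ffunE prodr_ge0 // => i _; rewrite bern_ge0.
- under eq_bigr do rewrite ffunE.
  exact: (sum_prod_distr (mu := fun i => bern (p i))).
move=> x; rewrite ffunE; apply: eq_bigr => i _; rewrite /marginal.
rewrite big_mkcond /=.
transitivity (\sum_y bern_prod p y * (y i == x i)%:R).
  have := @sum_prod_marginal _ _ _ (fun i => bern (p i)) i
    (fun b => (b == x i)%:R) s1.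
  under [X in _ = X -> _]eq_bigr do rewrite mulr_natr mulrb.
  rewrite -big_mkcond big_pred1_eq => <-.
  by apply: eq_bigr => y _; rewrite ffunE.
by apply: eq_bigr => y _; rewrite mulr_natr mulrb.
Qed.

Lemma l1dist_bern_prod_le (R : realType) (n : nat) (p q : 'I_n -> R) :
  (forall i, 0 <= p i <= 1) -> (forall i, 0 <= q i <= 1) ->
  l1dist (bern_prod p) (bern_prod q) <= 2 * \sum_i `|p i - q i|.
Proof.
move=> p01 q01; rewrite /l1dist; under eq_bigr do rewrite !ffunE.
apply: le_trans (@l1_prod_le _ _ _ (fun i => bern (p i)) (fun i => bern (q i))
  _ _ _ _) _ => //=.
- by move=> i c; rewrite bern_ge0.
- by move=> i c; rewrite bern_ge0.
- by move=> i; rewrite sum_bern.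
- by move=> i; rewrite sum_bern.
rewrite mulr_sumr; apply: ler_sum => i _; rewrite big_bool /=.
have -> : 1 - p i - (1 - q i) = - (p i - q i) by ring.
by rewrite normrN mulr_natl mulr2n.
Qed.

(** If [p i = 0], the [i]-th unit vector has mass [0] under the first law and
    [q (1 - q)^(n-1) >= q (1 - n q)] under the second. Only these points are counted. *)
Lemma l1dist_bern_prod_ge (R : realType) (n : nat) (p : 'I_n -> R) (q : R) :
  0 <= q <= 1 ->
  #|[pred i | p i == 0]|%:R * (q * (1 - q *+ n))
    <= l1dist (bern_prod p) (bern_prod (fun=> q)).
Proof.
move=> q01; have [q0 q1] := andP q01.
pose e (i : 'I_n) : cube n := [ffun k => k == i].
have e_inj : injective e.
  by move=> i j /ffunP/(_ i); rewrite !ffunE eqxx => /esym/eqP.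
have eE (r : 'I_n -> R) i :
    bern_prod r (e i) = r i * \prod_(k | k != i) (1 - r k).
  rewrite ffunE (bigD1 i) //= ffunE eqxx /=; congr (_ * _).
  by apply: eq_bigr => k /negbTE ki; rewrite ffunE ki.
have bernoulli k : 1 - q *+ k <= (1 - q) ^+ k.
  elim: k => [|k IHk]; first by rewrite mulr0n subr0 expr0.
  rewrite exprS; apply: le_trans (ler_wpM2l _ IHk); last by rewrite subr_ge0.
  rewrite mulrS -subr_ge0.
  have -> : (1 - q) * (1 - q *+ k) - (1 - (q + q *+ k)) = q * (q *+ k) by ring.
  by rewrite mulr_ge0 // mulrn_wge0.
have qE i : q * (1 - q *+ n) <= bern_prod (fun=> q) (e i).
  rewrite eE ler_wpM2l // prodr_const cardC1 card_ord.
  apply: le_trans (bernoulli _) _; rewrite ler_wiXn2l ?leq_pred //; lra.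
rewrite /l1dist.
rewrite (bigID (mem (e @: [set i | p i == 0]))) /=.
apply: ler_wpDr; first by apply: sumr_ge0.
rewrite big_imset /=; last by move=> i j _ _; apply: e_inj.
rewrite -cardsE mulr_natl -sumr_const; apply: ler_sum => i.
rewrite inE => /eqP pi0.
rewrite [bern_prod p _]eE pi0 mul0r sub0r normrN.
exact: le_trans (qE i) (ler_norm _).
Qed.

(* Expanding the product over [t] writes it as a combination of the powers
   [p j ^+ t], where those with [t < D] cancel; the factor [r ^+ (t - D) >= 1]
   then turns the tail of the binomial sum into the full one. *)
Lemma column_l1_le (R : realFieldType) (J : finType) (nu p : J -> R)
    (m D : nat) (r b : R) :
  (forall t, (t < D)%N -> \sum_j nu j * p j ^+ t = 0) ->
  (forall j, 0 <= p j <= b) -> 1 <= r ->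
  \sum_(c : {ffun 'I_m -> bool}) `|\sum_j nu j * \prod_t bern (p j) (c t)|
    <= (\sum_j `|nu j|) * ((1 + 2 * r * b) ^+ m / r ^+ D).
Proof.
move=> mom pb r1.
have r0 : 0 < r by apply: lt_le_trans r1.
(* [bern p b = \sum_e sg b e * p ^+ e] *)
pose sg (b e : bool) : R := if e then (-1) ^+ ~~ b else (~~ b)%:R.
pose M t := \sum_j nu j * p j ^+ t.
pose w (e : {ffun 'I_m -> bool}) := (\sum_t (e t : nat))%N.
have expand (c : cube m) : \sum_j nu j * \prod_t bern (p j) (c t)
    = \sum_(e : {ffun 'I_m -> bool}) (\prod_t sg (c t) (e t)) * M (w e).
  under [RHS]eq_bigr do rewrite mulr_sumr.
  rewrite exchange_big /=; apply: eq_bigr => j _.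
  under [RHS]eq_bigr do rewrite mulrCA /w expr_sum -big_split /=.
  rewrite -mulr_sumr; congr (_ * _).
  rewrite -(bigA_distr_bigA (fun t (e : bool) => sg (c t) e * p j ^+ e)).
  apply: eq_bigr => t _; rewrite big_bool /= /sg.
  by case: (c t);
    rewrite /= !(expr0, expr1, mul1r, mul0r, addr0, mulN1r) // addrC.
(* Summed over one bit of [c], the absolute value of [sg] is [2] if that bit of [e] is set and [1]
   otherwise. *)
have sgE (e : cube m) :
    \sum_(c : {ffun 'I_m -> bool}) `|\prod_t sg (c t) (e t)| = 2 ^+ w e.
  under eq_bigr do rewrite normr_prod.
  rewrite -(bigA_distr_bigA (fun t (b : bool) => `|sg b (e t)|)).
  rewrite /w expr_sum; apply: eq_bigr => t _; rewrite big_bool /sg.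
  by case: (e t); rewrite /= ?expr0 ?expr1 ?normrN ?normr1 ?normr0 ?add0r.
apply: (@le_trans _ _ (\sum_(e : {ffun 'I_m -> bool}) 2 ^+ w e * `|M (w e)|)).
  under [X in _ <= X]eq_bigr do rewrite -sgE mulr_suml.
  rewrite [X in _ <= X]exchange_big /=; apply: ler_sum => c _.
  rewrite expand; apply: le_trans (ler_norm_sum _ _ _) _.
  by apply: ler_sum => e _; rewrite normrM.
have Mle t : `|M t| <= (\sum_j `|nu j|) * ((r * b) ^+ t / r ^+ D).
  (* The sign of [b] is read off from some [j], since [J] may be empty. *)
  have b0 (j : J) : 0 <= b by have /andP[/le_trans h /h] := pb j.
  have [tD|Dt] := ltnP t D.
    rewrite /M mom // normr0 mulr_suml; apply: sumr_ge0 => j _.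
    by rewrite mulr_ge0 // divr_ge0 ?exprn_ge0 ?mulr_ge0 ?(b0 j) // ltW.
  rewrite mulr_suml; apply: le_trans (ler_norm_sum _ _ _) _.
  apply: ler_sum => j _; rewrite normrM ler_wpM2l //.
  have [p0 pjb] := andP (pb j).
  rewrite ger0_norm ?exprn_ge0 // exprMn mulrAC.
  apply: (@le_trans _ _ (b ^+ t)); first by rewrite lerXn2r ?nnegrE // (b0 j).
  rewrite ler_peMl ?exprn_ge0 ?(b0 j) // ler_pdivlMr ?exprn_gt0 // mul1r.
  by rewrite ler_weXn2l.
apply: (@le_trans _ _ (\sum_(e : cube m)
    2 ^+ w e * ((\sum_j `|nu j|) * ((r * b) ^+ w e / r ^+ D)))).
  by apply: ler_sum => e _; rewrite ler_wpM2l ?exprn_ge0.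
rewrite le_eqVlt; apply/orP; left; apply/eqP.
under eq_bigr do rewrite mulrCA [_ * (_ / _)]mulrA -exprMn.
rewrite -mulr_sumr -mulr_suml; congr (_ * (_ / _)).
under eq_bigr do rewrite /w expr_sum.
rewrite -(bigA_distr_bigA (fun (t : 'I_m) (e : bool) => (2 * (r * b)) ^+ e)).
rewrite prodr_const card_ord big_bool /= expr0 expr1 addrC.
by rewrite mulrA.
Qed.

(** * Mixtures over random means *)

Definition mixture_accept (R : realType) (J : finType) (p mu : J -> R)
    (n m : nat) (A : m.-tuple (cube n) -> R) : R :=
  \sum_(a : {ffun 'I_n -> J})
    (\prod_i mu (a i)) * accept_prob (bern_prod (fun i => p (a i))) A.

(** The [m] bits of a column share a single draw [j], so they are independent only conditionally on
    it. *)
Definition column_law (R : realType) (J : finType) (p mu : J -> R) (m : nat)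
    (c : {ffun 'I_m -> bool}) : R :=
  \sum_j mu j * \prod_t bern (p j) (c t).

Lemma column_law_ge0 (R : realType) (J : finType) (p mu : J -> R) (m : nat)
    (c : {ffun 'I_m -> bool}) :
  (forall j, 0 <= p j <= 1) -> (forall j, 0 <= mu j) -> 0 <= column_law p mu c.
Proof.
move=> p01 mu0; apply: sumr_ge0 => j _; rewrite mulr_ge0 //.
by apply: prodr_ge0 => t _; rewrite bern_ge0.
Qed.

Lemma sum_column_law (R : realType) (J : finType) (p mu : J -> R) (m : nat) :
  \sum_j mu j = 1 -> \sum_(c : {ffun 'I_m -> bool}) column_law p mu c = 1.
Proof.
move=> mu1; rewrite exchange_big /= -[RHS]mu1; apply: eq_bigr => j _.
rewrite -mulr_sumr (sum_prod_distr (mu := fun=> bern (p j))) ?mulr1 // => _.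
exact: sum_bern.
Qed.

Definition columns (n m : nat) (s : m.-tuple (cube n)) :
    {ffun 'I_n -> {ffun 'I_m -> bool}} :=
  [ffun i => [ffun t => tnth s t i]].

Lemma columns_bij (n m : nat) : bijective (@columns n m).
Proof.
pose rows (c : {ffun 'I_n -> {ffun 'I_m -> bool}}) : m.-tuple (cube n) :=
  [tuple [ffun i => c i t] | t < m].
exists rows => [s|c].
  apply: eq_from_tnth => t; rewrite tnth_mktuple.
  by apply/ffunP => i; rewrite !ffunE.
by apply/ffunP => i; apply/ffunP => t; rewrite !ffunE tnth_mktuple ffunE.
Qed.

(** The indices [a i] are independent, and so are the coordinates given [a]; the average over [a]
    therefore factorises over the columns of the sample. *)
Lemma mixture_acceptE (R : realType) (J : finType) (p mu : J -> R)
    (n m : nat) (A : m.-tuple (cube n) -> R) :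
  mixture_accept p mu A
    = \sum_s A s * \prod_i column_law p mu (columns s i).
Proof.
rewrite /mixture_accept /accept_prob.
under eq_bigr do rewrite mulr_sumr.
rewrite exchange_big /=; apply: eq_bigr => s _.
rewrite (bigA_distr_bigA
  (fun i j => mu j * \prod_t bern (p j) (columns s i t))).
rewrite mulr_sumr; apply: eq_bigr => a _.
rewrite mulrA mulrC big_split /=; congr (_ * (_ * _)).
rewrite /iid [RHS]exchange_big; apply: eq_bigr => t _.
by rewrite ffunE; apply: eq_bigr => i _; rewrite !ffunE.
Qed.

(** As [A] takes values in [[0, 1]], the gap is at most the L1 distance of the two sample laws.
    These are products of [n] identical column laws, so the hybrid bound applies. *)
Lemma mixture_accept_dist (R : realType) (J : finType) (p mu mu' : J -> R)
    (n m : nat) (A : m.-tuple (cube n) -> R) :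
  (forall j, 0 <= p j <= 1) -> (forall s, 0 <= A s <= 1) ->
  (forall j, 0 <= mu j) -> \sum_j mu j = 1 ->
  (forall j, 0 <= mu' j) -> \sum_j mu' j = 1 ->
  `|mixture_accept p mu A - mixture_accept p mu' A|
    <= n%:R * \sum_(c : {ffun 'I_m -> bool})
        `|\sum_j (mu j - mu' j) * \prod_t bern (p j) (c t)|.
Proof.
move=> p01 A01 mu0 mu1 mu'0 mu'1; rewrite !mixture_acceptE -sumrB.
apply: le_trans (ler_norm_sum _ _ _) _.
apply: (@le_trans _ _ (\sum_(c : {ffun 'I_n -> {ffun 'I_m -> bool}})
    `|\prod_i column_law p mu (c i) - \prod_i column_law p mu' (c i)|)).
  rewrite [X in _ <= X](reindex (@columns n m)) /=; last first.
    exact/onW_bij/columns_bij.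
  apply: ler_sum => s _; rewrite -mulrBr normrM ler_piMl //.
  by have /andP[? ?] := A01 s; rewrite ger0_norm.
apply: le_trans (@l1_prod_le _ _ n (fun=> @column_law _ _ p mu m)
  (fun=> @column_law _ _ p mu' m) _ _ _ _) _.
- by move=> _ c; apply: column_law_ge0.
- by move=> _ c; apply: column_law_ge0.
- by move=> _; apply: sum_column_law.
- by move=> _; apply: sum_column_law.
rewrite sumr_const card_ord -[X in X <= _]mulr_natl ler_wpM2l //.
apply: ler_sum => c _; rewrite /column_law -sumrB.
by under eq_bigr do rewrite -mulrBl.
Qed.

Lemma accept_prob_bounds (R : realType) (T : finType) (P : {ffun T -> R})
    (m : nat) (A : m.-tuple T -> R) :
  is_distribution P -> (forall s, 0 <= A s <= 1) -> 0 <= accept_prob P A <= 1.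
Proof.
case=> P0 P1 A01.
have iid0 s : 0 <= iid P s :> R by apply: prodr_ge0 => i _.
have iid1 : \sum_(s : m.-tuple T) iid P s = 1.
  rewrite -(sum_prod_distr (I := 'I_m) (mu := fun=> P)) //.
  rewrite (reindex (fun f : {ffun 'I_m -> T} => [tuple f i | i < m])) /=.
    by apply: eq_bigr => f _; apply: eq_bigr => i _; rewrite tnth_mktuple.
  apply: onW_bij; exists (fun s : m.-tuple T => [ffun i => tnth s i]) => [f|s].
    by apply/ffunP => i; rewrite ffunE tnth_mktuple.
  by apply: eq_from_tnth => i; rewrite tnth_mktuple ffunE.
apply/andP; split.
  by apply: sumr_ge0 => s _; rewrite mulr_ge0 //; case/andP: (A01 s).
rewrite -iid1; apply: ler_sum => s _; rewrite ler_piMr //.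
by case/andP: (A01 s).
Qed.

(** Instead of a concentration argument, acceptance is bounded by affine functions of averages over
    the coordinates, which have explicit expectations. This gives at least [3/5] under [near] and at
    most [13/30] under [far]. *)
Lemma mixture_gap (R : realType) (J : finType) (j0 : J) (x far near : J -> R)
    (n m : nat) (eps : R) (A : m.-tuple (cube n) -> R) :
  (0 < n)%N -> 0 < eps <= 1 / 10 ->
  x j0 = 0 -> (forall j, 0 <= 4 * eps * x j / n%:R <= 1) ->
  (forall j, 0 <= far j) -> \sum_j far j = 1 -> 19 / 20 <= far j0 ->
  (forall j, 0 <= near j) -> \sum_j near j = 1 ->
  \sum_j near j * `|x j - 1| <= 1 / 200 ->
  (forall s, 0 <= A s <= 1) ->
  (forall P, is_product_distribution P ->
     correct_answer eps (l1dist P (bern_prod (fun=> 4 * eps / n%:R)))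
       (accept_prob P A)) ->
  1 / 10 < mixture_accept (fun j => 4 * eps * x j / n%:R) near A
           - mixture_accept (fun j => 4 * eps * x j / n%:R) far A.
Proof.
move=> n_gt0 /andP[eps_gt0 eps_le] x0 p01 far0 far1 far_j0.
move=> near0 near1 near_x A01.
set p := fun j => 4 * eps * x j / n%:R; set q := 4 * eps / n%:R => correct.
have n0 : 0 < n%:R :> R by rewrite ltr0n.
have n1 : 1 <= n%:R :> R by rewrite ler1n.
have q01 : 0 <= q <= 1.
  rewrite divr_ge0 /=; [|lra|lra].
  by rewrite ler_pdivrMr // mul1r; lra.
pose P (a : {ffun 'I_n -> J}) := bern_prod (fun i => p (a i)).
have Pd a : is_product_distribution (P a) by apply: bern_prodP => i; exact: p01.
have acc01 a : 0 <= accept_prob (P a) A <= 1.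
  by apply: accept_prob_bounds => //; case: (Pd a).
pose d (a : {ffun 'I_n -> J}) := (\sum_i `|x (a i) - 1|) / n%:R.
pose z (a : {ffun 'I_n -> J}) := (\sum_i (a i != j0)%:R) / n%:R : R.
have dE (a : {ffun 'I_n -> J}) :
    l1dist (P a) (bern_prod (fun=> q)) <= 8 * eps * d a.
  apply: le_trans (l1dist_bern_prod_le _ _) _ => //.
    by move=> i; exact: p01.
  rewrite /d mulr_suml !mulr_sumr; apply: ler_sum => i _.
  have -> : p (a i) - q = 4 * eps * (x (a i) - 1) / n%:R.
    by rewrite /p /q; field; rewrite gt_eqF.
  rewrite !normrM normfV (ger0_norm (ltW n0)) (ger0_norm (ltW eps_gt0)).
  rewrite (ger0_norm (_ : 0 <= 4)) // le_eqVlt; apply/orP; left; apply/eqP.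
  by field; rewrite gt_eqF.
have zE (a : {ffun 'I_n -> J}) :
    (1 - z a) * (4 * eps * (1 - 4 * eps)) <= l1dist (P a) (bern_prod (fun=> q)).
  apply: le_trans (l1dist_bern_prod_ge (fun i => p (a i)) q01).
  have -> : q *+ n = 4 * eps by rewrite -mulr_natr divfK // gt_eqF.
  have -> : (1 - z a) * (4 * eps * (1 - 4 * eps))
      = (n%:R - n%:R * z a) * (q * (1 - 4 * eps)).
    by rewrite /q; field; rewrite gt_eqF.
  rewrite ler_wpM2r //; first by rewrite mulr_ge0 //; [case/andP: q01 | lra].
  have -> : n%:R * z a = \sum_i (a i != j0)%:R.
    by rewrite /z mulrC divfK // gt_eqF.
  rewrite lerBlDr -{1}[n]card_ord -sum1_card natr_sum.
  rewrite -sum1_card natr_sum [X in _ <= X + _]big_mkcond /= -big_split /=.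
  apply: ler_sum => i _; rewrite inE.
  case: (eqVneq (a i) j0) => [->|_]; last by case: ifP => _ /=; lra.
  by rewrite /p x0 mulr0 mul0r eqxx /=; lra.
(* For [d a < 1/20] the distance is at most [8 eps / 20 < eps / 2]; otherwise the left side is not
   positive. *)
have near_acc (a : {ffun 'I_n -> J}) :
    2 / 3 * (1 - 20 * d a) <= accept_prob (P a) A.
  have [da|da] := ltP (d a) (1 / 20); last first.
    by have /andP[? _] := acc01 a; lra.
  have [h _] := correct _ (Pd a).
  have d0 : 0 <= d a by rewrite divr_ge0 ?sumr_ge0 // ltW.
  suff /h : l1dist (P a) (bern_prod (fun=> q)) < eps / 2 by lra.
  apply: le_lt_trans (dE a) _.
  rewrite (_ : 8 * eps * d a = eps * (8 * d a)); last by ring.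
  by rewrite ltr_pM2l //; lra.
(* For [z a < 1/2] correctness on far inputs applies; otherwise the right side exceeds [1]. *)
have far_acc (a : {ffun 'I_n -> J}) : accept_prob (P a) A <= 1 / 3 + 2 * z a.
  have z0 : 0 <= z a by rewrite divr_ge0 ?sumr_ge0 // ltW.
  have [za|za] := ltP (z a) (1 / 2); last first.
    by have /andP[_ ?] := acc01 a; lra.
  have [_ h] := correct _ (Pd a).
  suff /h : eps < l1dist (P a) (bern_prod (fun=> q)) by lra.
  apply: lt_le_trans (zE a).
  (* The lower bound minus [eps] is twice the sum of this product and the next one. The next one is
     positive because [eps <= 1/10 < 1/8]. *)
  have : 0 < eps * ((1 - 2 * z a) * (1 - 4 * eps)).
    by rewrite !mulr_gt0 //; lra.
  have : 0 < eps * (1 / 2 - 4 * eps) by rewrite mulr_gt0 //; lra.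
  lra.
have mean (mu h : J -> R) : \sum_j mu j = 1 ->
    \sum_(a : {ffun 'I_n -> J}) (\prod_i mu (a i)) * ((\sum_i h (a i)) / n%:R)
      = \sum_j mu j * h j.
  move=> mu1; under eq_bigr do rewrite mulrA mulr_sumr.
  rewrite -mulr_suml exchange_big /=.
  under eq_bigr do rewrite (sum_prod_marginal (mu := fun=> mu)) //.
  by rewrite sumr_const card_ord -[X in X / _]mulr_natr mulfK // gt_eqF.
have mu_ge0 (mu : J -> R) (a : {ffun 'I_n -> J}) :
    (forall j, 0 <= mu j) -> 0 <= \prod_i mu (a i).
  by move=> mu0; apply: prodr_ge0.
have near_mix : 2 / 3 * (9 / 10) <= mixture_accept p near A.
  apply: (@le_trans _ _ (\sum_(a : {ffun 'I_n -> J})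
      (\prod_i near (a i)) * (2 / 3 * (1 - 20 * d a)))); last first.
    by apply: ler_sum => a _; rewrite ler_wpM2l // mu_ge0.
  under eq_bigr do rewrite mulrCA mulrBr mulr1 [_ * (20 * _)]mulrCA.
  rewrite -mulr_sumr sumrB -mulr_sumr (mean near (fun j => `|x j - 1|)) //.
  rewrite (sum_prod_distr (mu := fun=> near)) //; lra.
have far_mix : mixture_accept p far A <= 1 / 3 + 2 * (1 / 20).
  apply: (@le_trans _ _ (\sum_(a : {ffun 'I_n -> J})
      (\prod_i far (a i)) * (1 / 3 + 2 * z a))).
    apply: ler_sum => a _; apply: ler_wpM2l; last exact: far_acc.
    exact: mu_ge0.
  under eq_bigr do rewrite mulrDr [_ * (2 * _)]mulrCA.
  rewrite big_split /= -mulr_suml -mulr_sumr.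
  rewrite (mean far (fun j => (j != j0)%:R)) //.
  rewrite (sum_prod_distr (mu := fun=> far)) //.
  have -> : \sum_j far j * (j != j0)%:R = 1 - far j0.
    rewrite -[X in X - _]far1 (bigD1 j0) //= eqxx mulr0 add0r.
    rewrite [in RHS](bigD1 j0) //= addrC addrK.
    by apply: eq_bigr => j ->; rewrite mulr1.
  lra.
lra.
Qed.

(** * The lower bound *)

(** Invert [1 + x <= expR x] at [x = - 1/2]. *)
Lemma expR_half_le2 (R : realType) : expR (1 / 2) <= 2 :> R.
Proof.
have := @expR_ge1Dx R (- (1 / 2)); rewrite expRN -[(expR _)^-1]mul1r.
by rewrite ler_pdivlMr ?expR_gt0 //; lra.
Qed.

Lemma node_bounds (R : realFieldType) (K : R) (L j : nat) :
  51 <= K -> (0 < L)%N -> (j < L.+3)%N -> 0 <= node K j <= K * L%:R ^+ 2.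
Proof.
move=> K51 L0 jL; have K0 : 0 <= K by lra.
have KL : K <= K * L%:R ^+ 2 by rewrite ler_peMr // exprn_ege1 // ler1n.
case: j jL => [|[|[|k]]] kL /=; try lra.
by rewrite mulr_ge0 ?sqr_ge0 //= ler_wpM2l // lerXn2r ?nnegrE // ler_nat.
Qed.

(** Correctness forces a gap above [1/10] between the mixtures, whereas [n] columns, each
    contributing at most [2 / 2^L], allow only [1/16] once [32 n <= 2^L]. The condition [K L^2 <= n]
    keeps all means in [[0, 1]]. *)
Lemma no_tester (R : realType) (K : R) (n m L : nat) (eps : R)
    (A : m.-tuple (cube n) -> R) :
  1000 * 100 <= K -> (0 < L)%N -> 0 < eps <= 1 / 10 ->
  K * L%:R ^+ 2 <= n%:R -> 16 * K * L%:R * m%:R <= n%:R ->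
  (32 * n <= 2 ^ L)%N ->
  (forall s, 0 <= A s <= 1) ->
  ~ (forall P, is_product_distribution P ->
       correct_answer eps (l1dist P (bern_prod (fun=> 4 * eps / n%:R)))
         (accept_prob P A)).
Proof.
move=> K_ge L_gt0 eps01 KLn KLm n2L A01 correct; have /andP[eps0 eps1] := eps01.
have K0 : 0 < K by lra.
have LR0 : 1 <= L%:R :> R by rewrite ler1n.
have n0 : 0 < n%:R :> R.
  by apply: lt_le_trans KLn; rewrite mulr_gt0 // exprn_gt0 // ltr0n.
have [far [near [[far0 far1] [near0 near1] moment far_j0 near_x]]] :=
  matched_priors L K_ge.
have node_le (j : 'I_L.+3) : 0 <= node K j <= K * L%:R ^+ 2.
  by apply: node_bounds => //; lra.
pose p (j : 'I_L.+3) := 4 * eps * node K j / n%:R.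
pose b := K * L%:R ^+ 2 / n%:R.
have b1 : b <= 1 by rewrite ler_pdivrMr // mul1r.
have pb j : 0 <= p j <= b.
  have /andP[x0 xle] := node_le j.
  rewrite divr_ge0 ?mulr_ge0 ?(ltW n0) ?(ltW eps0) //=.
  rewrite ler_wpM2r ?invr_ge0 ?(ltW n0) //.
  apply: le_trans xle; rewrite ler_piMl //; lra.
have p01 j : 0 <= p j <= 1 by have := pb j; lra.
have gap := mixture_gap (j0 := ord0) (x := fun j : 'I_L.+3 => node K j)
  (n := n) (ltac:(rewrite -(ltr_nat R); exact: n0)) eps01 erefl p01
  far0 far1 far_j0 near0 near1 near_x A01 correct.
have := mixture_accept_dist p01 A01 far0 far1 near0 near1.
rewrite distrC => dist.
have {}dist := le_trans (ler_norm _) dist.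
(* With [r = 4] the tail gains [4^L]. Half of it is spent on [(1 + 8 b)^m <= expR (L / 2) <= 2^L],
   which leaves [2^L]. *)
have col := @column_l1_le R _ (fun j => far j - near j) p m L 4 b.
have {}col : \sum_(c : {ffun 'I_m -> bool})
    `|\sum_j (far j - near j) * \prod_t bern (p j) (c t)|
    <= 2 * (2 ^+ L)^-1.
  apply: le_trans (col _ pb _) _; last first.
  - apply: ler_pM.
    + exact: sumr_ge0.
    + rewrite divr_ge0 ?exprn_ge0 //; have := pb ord0; lra.
    + apply: (@le_trans _ _ (\sum_j (far j + near j))).
        apply: ler_sum => j _; apply: le_trans (ler_normB _ _) _.
        by rewrite !ger0_norm.
      by rewrite big_split /= far1 near1.
    + have -> : (4 : R) = 2 * 2 by ring.
      rewrite exprMn ler_pdivrMr ?mulr_gt0 ?exprn_gt0 // mulKf; last first.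
        by rewrite expf_eq0 pnatr_eq0 andbF.
      apply: (@le_trans _ _ (expR (8 * b) ^+ m)).
        rewrite lerXn2r ?nnegrE ?expR_ge0 //; first by have := pb ord0; lra.
        by apply: le_trans (expR_ge1Dx _); lra.
      rewrite -expRM_natr.
      apply: (@le_trans _ _ (expR (1 / 2 * L%:R))).
        have -> : 8 * b * m%:R = 8 * K * L%:R ^+ 2 * m%:R / n%:R.
          by rewrite /b; ring.
        rewrite ler_expR ler_pdivrMr //.
        have : 16 * K * L%:R * m%:R * L%:R <= n%:R * L%:R by rewrite ler_wpM2r.
        lra.
      rewrite expRM_natr lerXn2r ?nnegrE ?expR_ge0 //.
      exact: expR_half_le2.
  - lra.
  - move=> t tL; under eq_bigr => j _.
      have -> : (far j - near j) * p j ^+ t =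
          (4 * eps / n%:R) ^+ t * ((far j - near j) * node K j ^+ t).
        by rewrite /p [_ * node K j / _]mulrAC exprMn mulrCA.
      over.
    by rewrite -mulr_sumr moment ?mulr0 // (leq_trans tL) // (leq_addl 2 L).
have : n%:R * (2 * (2 ^+ L)^-1) <= 1 / 16 :> R.
  rewrite mulrA ler_pdivrMr ?exprn_gt0 //.
  move: n2L; rewrite -(ler_nat R) natrM natrX; lra.
have : n%:R * \sum_(c : {ffun 'I_m -> bool})
    `|\sum_j (far j - near j) * \prod_t bern (p j) (c t)|
    <= n%:R * (2 * (2 ^+ L)^-1) by rewrite ler_wpM2l // ltW.
move: gap dist; rewrite -/p; lra.
Qed.

(** * Choice of [L] and assembly *)

Lemma cube_le_exp2 (t : nat) : (t ^ 3 <= 8 * 2 ^ t)%N.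
Proof.
elim: t => // t IHt; case: (ltnP t 4) => [|t4].
  by case: t IHt => [|[|[|[|]]]].
(* From [t = 4] on, [(t+1)^3 <= 2 t^3]. *)
apply: (@leq_trans (2 * t ^ 3)); last first.
  by rewrite [(2 ^ t.+1)%N]expnS mulnCA leq_mul2l IHt.
rewrite !expnS expn0; nia.
Qed.

(** For [t >= 6] and [t >= 32 K], [K (t+6)^2 <= 4 K t^2], and [4 K t^3 <= 32 K 2^t <= t 2^t]; cancel
    [t] and use [2^t <= n]. *)
Lemma sqr_log_le_linear (R : realType) (K : R) : 0 < K -> exists N : nat,
  forall n, (N <= n)%N -> (6 <= trunc_log 2 n)%N /\
    K * (trunc_log 2 n + 6)%:R ^+ 2 <= n%:R.
Proof.
move=> K0; pose T := maxn 6 (Num.bound (32 * K)).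
exists (2 ^ T)%N => n Nn; set t := trunc_log 2 n.
have n0 : (0 < n)%N by apply: leq_trans Nn; rewrite expn_gt0.
have Tt : (T <= t)%N by rewrite trunc_log_max.
have t6 : (6 <= t)%N by apply: leq_trans Tt; rewrite leq_maxl.
split=> //.
have tK : 32 * K <= t%:R.
  apply: le_trans (ltW (archi_boundP _)) _; first by lra.
  by rewrite ler_nat (leq_trans _ Tt) // leq_maxr.
have t0 : 0 < t%:R :> R by rewrite ltr0n; lia.
apply: (@le_trans _ _ (2 ^ t)%:R); last by rewrite ler_nat trunc_logP.
have := cube_le_exp2 t; rewrite -(ler_nat R) natrX natrM => h3.
apply: (@le_trans _ _ (K * (4 * t%:R ^+ 2))).
  rewrite ler_pM2l // (_ : 4 * t%:R ^+ 2 = (2 * t%:R) ^+ 2); last by ring.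
  by rewrite lerXn2r ?nnegrE ?mulr_ge0 // -natrM ler_nat; lia.
rewrite -(ler_pM2r t0).
have -> : K * (4 * t%:R ^+ 2) * t%:R = 4 * K * t%:R ^+ 3 by ring.
have : 4 * K * t%:R ^+ 3 <= 4 * K * (8 * (2 ^ t)%:R).
  by rewrite ler_pM2l //; lra.
have : 32 * K * (2 ^ t)%:R <= t%:R * (2 ^ t)%:R by rewrite ler_wpM2r.
lra.
Qed.

Lemma trunc_log2_le_ln (R : realType) (n : nat) : (0 < n)%N ->
  (trunc_log 2 n)%:R <= 2 * ln n%:R :> R.
Proof.
move=> n0; set t := trunc_log 2 n.
have : ln ((2 ^ t)%:R) <= ln n%:R :> R.
  by rewrite ler_ln ?posrE ?ltr0n ?expn_gt0 // ler_nat trunc_logP.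
rewrite natrX lnXn // -[_ *+ t]mulr_natr => h.
have ln2 : 1 / 2 <= ln 2 :> R.
  by rewrite -[1 / 2]expRK ler_ln ?posrE ?expR_gt0 // expR_half_le2.
have := ler_wpM2r (ler0n R t) ln2; lra.
Qed.

(** For a fixed [Q] its samples become internal randomness, so a closeness tester yields an identity
    tester against [Q]. *)
Lemma accept_prob2E (R : realType) (T : finType) (P Q : {ffun T -> R})
    (mP mQ : nat) (A : mP.-tuple T -> mQ.-tuple T -> R) :
  accept_prob2 P Q A = accept_prob P (fun s => accept_prob Q (A s)).
Proof.
apply: eq_bigr => s _; rewrite mulr_sumr; apply: eq_bigr => t _.
by rewrite mulrA.
Qed.

Theorem theorem4p28 (R : realType) :
  exists eps0 : R, 0 < eps0 < 1 /\
  exists (c : R) (N : nat), 0 < c /\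
  forall (n : nat) (eps : R), (N <= n)%N -> 0 < eps <= eps0 ->
    (forall (mP mQ : nat)
            (A : mP.-tuple (cube n) -> mQ.-tuple (cube n) -> R),
       closeness_tester eps A -> c * (n%:R / ln n%:R) <= (mP + mQ)%:R) /\
    (forall (m : nat)
            (A : {ffun cube n -> R} -> m.-tuple (cube n) -> R),
       identity_tester eps A -> c * (n%:R / ln n%:R) <= m%:R).
Proof.
exists (1 / 10); split; first by lra.
pose K : R := 1000 * 100.
have K_ge : 1000 * 100 <= K by [].
clearbody K; have K0 : 0 < K by lra.
have [N Nlarge] := sqr_log_le_linear K0.
(* With [t = trunc_log 2 n] and [L = t + 6 <= 2 t <= 4 ln n], the factor [16 K L] is at most
   [64 K ln n]. *)
exists (64 * K)^-1, N; split; first by rewrite invr_gt0 mulr_gt0.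
move=> n eps /Nlarge[t6 KL] eps01; have /andP[eps_gt0 eps_le] := eps01.
have n0 : (0 < n)%N by case: n t6 {KL}.
have n1 : 1 <= n%:R :> R by rewrite ler1n.
have t_ln := trunc_log2_le_ln R n0.
have t6R : 6 <= (trunc_log 2 n)%:R :> R by rewrite ler_nat.
have ln0 : 0 < ln n%:R :> R by lra.
pose Q : {ffun cube n -> R} := bern_prod (fun=> 4 * eps / n%:R).
have Qd : is_product_distribution Q.
  apply: bern_prodP => _; rewrite divr_ge0 ?ler_pdivrMr; lra.
(* Both claims reduce to testing against this single [Q]. *)
have lower m (A : m.-tuple (cube n) -> R) : (forall s, 0 <= A s <= 1) ->
    (forall P, is_product_distribution P ->
       correct_answer eps (l1dist P Q) (accept_prob P A)) ->
    (64 * K)^-1 * (n%:R / ln n%:R) <= m%:R.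
  move=> A01 correct; rewrite leNgt; apply/negP => m_lt.
  apply: (@no_tester R K n m (trunc_log 2 n + 6) eps A _ _ _ KL) => //.
  - by rewrite addn_gt0 orbT.
  - have : 64 * K * ln n%:R * m%:R <= n%:R.
      move: m_lt; have -> : (64 * K)^-1 * (n%:R / ln n%:R)
          = n%:R / (64 * K * ln n%:R) by field; rewrite !gt_eqF.
      by rewrite ltr_pdivlMr ?mulr_gt0 // mulrC => /ltW.
    apply: le_trans; rewrite ler_wpM2r //.
    rewrite (_ : 64 * K * ln n%:R = 16 * K * (4 * ln n%:R)); last by ring.
    by rewrite ler_pM2l ?mulr_gt0 // natrD; lra.
  (* The offset [6] supplies the [32] and one more doubling, as [n < 2^(t+1)]. *)
  - rewrite addnC expnD -[(2 ^ 6)%N]/(32 * 2)%N -mulnA leq_mul2l /=.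
    by rewrite -expnS ltnW // trunc_log_ltn.
split=> [mP mQ A [A01 correct]|m A [A01 correct]]; last first.
  by apply: (lower m (A Q)) => // P Pd; apply: correct.
apply: le_trans (lower mP (fun s => accept_prob Q (A s)) _ _) _.
- by move=> s; apply: accept_prob_bounds => //; case: Qd.
- by move=> P Pd; rewrite -accept_prob2E; apply: correct.
by rewrite ler_nat leq_addr.
Qed.
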